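(* Let $d\in\mathbb{N}=\{0,1,2,\ldots\}$, $n\in\{1,2,\ldots\}$, $\boldsymbol{\alpha}=(\alpha_1,\ldots,\alpha_n)$ with $0<\alpha_1\le\cdots\le\alpha_n<+\infty$, and let $\mathbb{H}(d,\boldsymbol{\alpha})$ be the corank $1$ Carnot group with projections $\{\pi_j\}_{j=1}^{d+2n}$. Fix $D\in\mathbb{R}$ and $c_j>0$, $1\le j\le d+2n$. Then the following two assertions are equivalent: (1) For any $d+2n$ non-negative measurable functions $f_j:\mathbb{R}^{d+2n}\to[0,+\infty)$, $1\le j\le d+2n$, $$\int_{\mathbb{H}(d,\boldsymbol{\alpha})}\prod_{j=1}^{d+2n}f_j(\pi_j(x,t))\,dx\,dt\le e^D\prod_{j=1}^{d+2n}\left(\int_{\mathbb{R}^{d+2n}}f_j^{1/c_j}(\hat x_j,t)\,d\hat x_j\,dt\right)^{c_j}.$$ (2) For every $f\in\mathcal{D}^{+,\mathcal{P}}_{d+2n+1}$, $$\sum_{j=1}^{d+2n}c_j\,S(f_{(\pi_j)})\le S(f)+D.$$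
   Context: The group $\mathbb{H}(d,\boldsymbol{\alpha})$ is $\mathbb{R}^{d+2n}\times\mathbb{R}\cong\mathbb{R}^{d+2n+1}$ (points $(x,t)$) with group law $$(x,t)\cdot(x',t')=\Big(x+x',\,t+t'+\tfrac12\sum_{j=1}^n\alpha_j(x_{d+2j-1}x'_{d+2j}-x_{d+2j}x'_{d+2j-1})\Big),$$ equipped with Lebesgue measure. With $\hat x_j$ denoting $x$ with its $j$-th coordinate deleted, the projections $\pi_j:\mathbb{R}^{d+2n+1}\to\mathbb{R}^{d+2n}$ are - $\pi_j(x,t)=(\hat x_j,t)$ for $1\le j\le d$; - $\pi_{d+2j-1}(x,t)=(\hat x_{d+2j-1},t+\tfrac{\alpha_j}{2}x_{d+2j-1}x_{d+2j})$ for $1\le j\le n$; - $\pi_{d+2j}(x,t)=(\hat x_{d+2j},t-\tfrac{\alpha_j}{2}x_{d+2j-1}x_{d+2j})$ for $1\le j\le n$. $\mathcal{D}^{+,\mathcal{P}}_{d+2n+1}$ is the set of probability densities $f\ge0$ on $\mathbb{R}^{d+2n+1}$ (measurable with $\int f=1$ with respect to Lebesgue measure) that are bounded and for which $\mathrm{supp}\,f:=\{f>0\}$ is a bounded set. For a probability density $f$ with respect to a measure $\mu$, the entropy is $S(f):=\int f\ln f\,d\mu$ with $0\ln0=0$ (note the sign: no minus sign). $f_{(\pi_j)}$ denotes the density with respect to Lebesgue measure on $\mathbb{R}^{d+2n}$ of the pushforward under $\pi_j$ of the measure $f\,dx\,dt$. For $f\in\mathcal{D}^{+,\mathcal{P}}_{d+2n+1}$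 these densities exist and all the entropies in (2) are finite. Convention: $0\cdot\infty=0$. *)

(* Defs.v *)
From HB Require Import structures.
From mathcomp Require Import all_boot all_order all_algebra.
From mathcomp Require Import all_classical all_reals all_analysis.
From mathcomp Require Import measurable_realfun.
From mathcomp Require Import zify ring.
Import Order.TTheory GRing.Theory Num.Theory.
Import numFieldNormedType.Exports.

Set Implicit Arguments.
Unset Strict Implicit.
Unset Printing Implicit Defensive.

Local Open Scope classical_set_scope.
Local Open Scope ring_scope.

(* Canonical-structure inference does not find the sigma-finiteness of a
   product of sigma-finite measures: the key [product_measure1] is taken by
   products of subprobabilities. *)
Lemma product_measure1_sigma_finite d1 d2 (T1 : measurableType d1)
    (T2 : measurableType d2) (R : realType)
    (m1 : {sigma_finite_measure set T1 -> \bar R})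
    (m2 : {sigma_finite_measure set T2 -> \bar R}) :
  sigma_finite setT (m1 \x m2)%E.
Proof.
have /sigma_finiteP[F [TF ndF Foo]] := sigma_finiteT m1.
have /sigma_finiteP[G [TG ndG Goo]] := sigma_finiteT m2.
exists (fun n => F n `*` G n).
  rewrite -setXTT TF TG predeqE => -[x y]; split.
    move=> [/= [n _ Fnx] [k _ Gky]]; exists (maxn n k) => //; split.
      by move: x Fnx; exact/subsetPset/ndF/leq_maxl.
    by move: y Gky; exact/subsetPset/ndG/leq_maxr.
  by move=> [n _ []/= ? ?]; split; exists n.
move=> k; have [? ?] := Foo k; have [? ?] := Goo k.
split; first exact: measurableX.
by rewrite product_measure1E// lte_mul_pinfty// ge0_fin_numE.
Qed.

(* R^m with its Borel sigma-algebra, the product sigma-algebra on tuples. *)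
Notation rvec R m := (m.-tuple (measurableTypeR R)).

Section lebesgue_rvec.
Context (R : realType).

Definition cons_rvec m (p : measurableTypeR R * rvec R m) : rvec R m.+1 :=
  [the m.+1.-tuple _ of p.1 :: p.2].

Lemma measurable_cons_rvec m : measurable_fun [set: _] (@cons_rvec m).
Proof. exact: measurable_cons. Qed.

HB.instance Definition _ m :=
  isMeasurableFun.Build _ _ _ _ (@cons_rvec m) (@measurable_cons_rvec m).

Section lebesgue_cons.
Local Open Scope ereal_scope.
Context (m : nat) (mu : {sigma_finite_measure set (rvec R m) -> \bar R}).

Definition lebesgue_cons : set (rvec R m.+1) -> \bar R :=
  pushforward (@lebesgue_measure R \x mu) (@cons_rvec m).

Let lebesgue_cons0 : lebesgue_cons set0 = 0.
Proof. exact: measure0. Qed.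

Let lebesgue_cons_ge0 A : 0 <= lebesgue_cons A.
Proof. exact: measure_ge0. Qed.

Let lebesgue_cons_sigma_additive : semi_sigma_additive lebesgue_cons.
Proof.
by apply: measure_semi_sigma_additive; exact: measurable_cons_rvec.
Qed.

HB.instance Definition _ := isMeasure.Build _ _ _ lebesgue_cons
  lebesgue_cons0 lebesgue_cons_ge0 lebesgue_cons_sigma_additive.

Let lebesgue_cons_sigma_finite : sigma_finite setT lebesgue_cons.
Proof.
have [F FT Foo] := product_measure1_sigma_finite (@lebesgue_measure R) mu.
pose u (t : rvec R m.+1) : measurableTypeR R * rvec R m :=
  (tnth t ord0, [tuple of behead t]).
have mu_ : measurable_fun [set: _] u.
  by apply/measurable_fun_pair;
    [exact: measurable_tnth|exact: measurable_behead].
have uK : u \o @cons_rvec m = id.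
  by apply/funext => -[x t]; congr pair; exact/val_inj.
exists (fun k => u @^-1` F k).
  by rewrite -preimage_bigcup -FT preimage_setT.
move=> k; have [mF Fk] := Foo k; split.
  by rewrite -[X in measurable X]setTI; exact: mu_.
by rewrite /lebesgue_cons /pushforward -comp_preimage uK.
Qed.

HB.instance Definition _ := Measure_isSigmaFinite.Build _ _ _ lebesgue_cons
  lebesgue_cons_sigma_finite.

End lebesgue_cons.

(* Lebesgue measure on R^m as an m-fold product measure, see
   [lebesgue_rvec_box]. *)
Fixpoint lebesgue_rvec m : {sigma_finite_measure set (rvec R m) -> \bar R} :=
  if m isn't m'.+1 then \d_([tuple] : rvec R 0)
  else lebesgue_cons (lebesgue_rvec m').

Lemma lebesgue_rvec_box m (A : 'I_m -> set (measurableTypeR R)) :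
    (forall i, measurable (A i)) ->
  (lebesgue_rvec m [set x | forall i, A i (tnth x i)] =
   \prod_(i < m) lebesgue_measure (A i))%E.
Proof.
elim: m A => [|m IH] A mA.
  rewrite big_ord0 [LHS](_ : _ = \d_([tuple] : rvec R 0) setT).
    by rewrite diracT.
  by congr (\d_ _ _); apply/seteqP; split=> // x _ [].
rewrite big_ord_recl -(IH (A \o lift ord0))//=.
rewrite /lebesgue_cons /pushforward -product_measure1E//.
  congr (_ _); apply/seteqP; split=> -[x t] /=.
    move=> H; split; first exact: (H ord0).
    by move=> i; have := H (lift ord0 i); rewrite tnthS.
  move=> [H0 H] i; case: (unliftP ord0 i) => [j|] ->; last exact: H0.
  by rewrite tnthS; exact: H.
rewrite (_ : [set x | _] = \bigcap_(i in [set: 'I_m])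
    ((fun x : rvec R m => tnth x i) @^-1` A (lift ord0 i))); last first.
  by apply/seteqP; split=> x H i; [move=> _|]; exact: H.
apply: fin_bigcap_measurable => // i _.
by rewrite -[X in measurable X]setTI; exact: measurable_tnth.
Qed.

End lebesgue_rvec.
Arguments lebesgue_rvec {R} m.

(* R^(m+1) with its points written (x, t), x in R^m. *)
Notation rvect R m := (rvec R m * measurableTypeR R)%type.

Section lebesgue_rvect.
Context (R : realType) (m : nat).

Definition lebesgue_rvect : set (rvect R m) -> \bar R :=
  (lebesgue_rvec m \x lebesgue_measure)%E.

HB.instance Definition _ := Measure.on lebesgue_rvect.
HB.instance Definition _ := Measure_isSigmaFinite.Build _ _ _ lebesgue_rvect
  (product_measure1_sigma_finite (lebesgue_rvec m) (@lebesgue_measure R)).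

End lebesgue_rvect.
Arguments lebesgue_rvect {R} m.

Section density.
Context d (T : measurableType d) (R : realType).

Record density (mu : {measure set T -> \bar R}) := Density {
  density_fun :> T -> R;
  density_measurable : measurable_fun [set: T] density_fun;
  density_ge0 : forall x, 0 <= density_fun x;
  density_int1 : (\int[mu]_x (density_fun x)%:E = 1)%E
}.

Local Open Scope ereal_scope.
Variables (mu : {measure set T -> \bar R}) (f : density mu).

Definition density_law : set T -> \bar R :=
  fun A => \int[mu]_(x in A) (f x)%:E.

Let density_law0 : density_law set0 = 0.
Proof. exact: integral_set0. Qed.

Let density_law_ge0 A : 0 <= density_law A.
Proof. by apply: integral_ge0 => x _; rewrite lee_fin density_ge0. Qed.

Let density_law_sigma_additive : semi_sigma_additive density_law.
Proof.
have mf : measurable_fun [set: T] (EFin \o f).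
  exact/measurable_EFinP/density_measurable.
apply: (semi_sigma_additive_nng_induced mf).
by move=> x; rewrite /= lee_fin density_ge0.
Qed.

HB.instance Definition _ := isMeasure.Build _ _ _ density_law
  density_law0 density_law_ge0 density_law_sigma_additive.

HB.instance Definition _ := Measure_isProbability.Build _ _ _ density_law
  (density_int1 f).

End density.

(* [ln 0 = 0], so the integrand is 0 where g vanishes. *)
Definition entropy d (T : measurableType d) (R : realType)
    (mu : set T -> \bar R) (g : T -> R) : \bar R :=
  (\int[mu]_x (g x * ln (g x))%:E)%E.

Section corank1.
Context (R : realType) (d n : nat).
Implicit Types (p q : rvect R (d + 2 * n)) (alpha : n.-tuple R).

(* Coordinates are indexed from 0: the 1-based x_{d+2j-1}, x_{d+2j}, alpha_j
   are x`_(d + 2 * k), x`_(d + 2 * k).+1, alpha`_k with k = j - 1. *)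
Definition corank1_mul alpha p q : rvect R (d + 2 * n) :=
  let x := p.1 : seq R in let x' := q.1 : seq R in
  ([tuple (tnth p.1 i : R) + tnth q.1 i | i < d + 2 * n],
   (p.2 : R) + q.2 + 2^-1 * \sum_(k < n) alpha`_k *
     (x`_(d + 2 * k) * x'`_(d + 2 * k).+1
      - x`_(d + 2 * k).+1 * x'`_(d + 2 * k))).

Definition corank1_proj_t alpha (j : nat) (x : seq R) (t : R) : R :=
  let a := alpha`_((j - d)./2) in
  if (j < d)%N then t
  else if ~~ odd (j - d) then t + a / 2 * (x`_j * x`_j.+1)
  else t - a / 2 * (x`_j.-1 * x`_j).

Definition corank1_proj alpha (j : 'I_(d + 2 * n)) p : rvect R (d + 2 * n).-1 :=
  ([tuple tnth p.1 (lift j i) | i < (d + 2 * n).-1],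
   corank1_proj_t alpha j p.1 p.2).

Let measurable_nth k :
  measurable_fun [set: rvect R (d + 2 * n)] (fun p => (p.1 : seq R)`_k : R).
Proof.
have [km|mk] := ltnP k (d + 2 * n); last first.
  rewrite (_ : (fun _ => _) = cst 0); first exact: measurable_cst.
  by apply/funext => p; rewrite nth_default// size_tuple.
rewrite (_ : (fun _ => _) =
    (fun x : rvec R (d + 2 * n) => tnth x (Ordinal km)) \o fst).
  exact: (measurableT_comp (measurable_tnth _)).
by apply/funext => p; exact: (esym (tnth_nth (0 : R) p.1 (Ordinal km))).
Qed.

Lemma measurable_corank1_proj alpha j : measurable_fun [set: _] (corank1_proj alpha j).
Proof.
apply/measurable_fun_pair => /=.
  apply/measurable_fun_tnthP => i.
  rewrite (_ : _ \o _ = (@tnth _ _ ^~ (lift j i)) \o fst).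
    exact: (measurableT_comp (measurable_tnth _)).
  by apply/funext => p /=; rewrite tnth_mktuple.
rewrite /corank1_proj_t; case: (j < d)%N; first exact: measurable_snd.
case: (odd (j - d)) => /=; last first.
  by apply: measurable_funD => //; apply: measurable_funM => //;
    apply: measurable_funM; exact: measurable_nth.
by apply: measurable_funB => //; apply: measurable_funM => //;
  apply: measurable_funM; exact: measurable_nth.
Qed.

HB.instance Definition _ alpha j := isMeasurableFun.Build _ _ _ _
  (corank1_proj alpha j) (measurable_corank1_proj alpha j).

(* The fibers of [corank1_proj alpha j] are the left cosets of the one-parameter
   subgroup in the j-th horizontal direction. *)
Lemma corank1_proj_mul alpha j p (s : R) :
  corank1_proj alpha j (corank1_mul alpha p
    ([tuple if i == j then s else 0 | i < d + 2 * n], 0)) = corank1_proj alpha j p.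
Proof.
set e := [tuple if _ then _ else _ | _ < _].
have eE k : (k < d + 2 * n)%N -> (e : seq R)`_k = if k == j then s else 0.
  by move=> km; rewrite -(tnth_nth 0 e (Ordinal km)) tnth_mktuple -val_eqE.
have mulE k : (k < d + 2 * n)%N ->
    ((corank1_mul alpha p (e, 0)).1 : seq R)`_k =
    (p.1 : seq R)`_k + if k == j then s else 0.
  move=> km; rewrite -eE// -(tnth_nth (0 : R) _ (Ordinal km)) tnth_mktuple.
  by rewrite !(tnth_nth (0 : R)).
have lt1 (k : 'I_n) : (d + 2 * k < d + 2 * n)%N.
  by rewrite ltn_add2l ltn_pmul2l.
have lt2 (k : 'I_n) : ((d + 2 * k).+1 < d + 2 * n)%N.
  by rewrite -addnS ltn_add2l -[(2 * k).+1]addn1; have := ltn_ord k; lia.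
congr pair.
  apply: eq_from_tnth => i; rewrite !tnth_mktuple.
  by rewrite eq_sym (negbTE (neq_lift _ _)) addr0.
rewrite /corank1_proj_t; case: ifPn => [jd|].
  rewrite /= big1 ?mulr0 ?addr0// => k _.
  by rewrite !eE// !ifN ?mulr0 ?subr0 ?mulr0//; apply/eqP; lia.
rewrite -leqNgt => dj.
have jlt := ltn_ord j.
have k0n : ((j - d)./2 < n)%N by lia.
pose k0 := Ordinal k0n.
case: ifPn => oj.
  have jE : (j : nat) = (d + 2 * k0)%N by rewrite /=; lia.
  have -> : (corank1_mul alpha p (e, 0)).2 =
      p.2 - 2^-1 * (alpha`_(j - d)./2 * ((p.1 : seq R)`_j.+1 * s)) :> R.
    rewrite /= addr0 (bigD1 k0)//= big1 => [|k kk0]; last first.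
      have : (k : nat) != k0 by [].
      move=> ?; rewrite !eE// !ifN ?mulr0 ?subr0 ?mulr0//; apply/eqP.
        by lia.
      by move: oj => /=; lia.
    rewrite (eE _ (lt1 k0)) (eE _ (lt2 k0)) -jE eqxx ifN; last by apply/eqP; lia.
    by rewrite mulr0 sub0r addr0 mulrN mulrN.
  have j1 : (j.+1 < d + 2 * n)%N by rewrite jE.
  rewrite !mulE// eqxx ifN; last by apply/eqP; lia.
  by field.
have jE : (j : nat) = (d + 2 * k0).+1%N by rewrite /=; lia.
have -> : (corank1_mul alpha p (e, 0)).2 =
    p.2 + 2^-1 * (alpha`_(j - d)./2 * ((p.1 : seq R)`_j.-1 * s)) :> R.
  rewrite /= addr0 (bigD1 k0)//= big1 => [|k kk0]; last first.
    have : (k : nat) != k0 by [].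
    by move=> ?; rewrite !eE// !ifN ?mulr0 ?subr0 ?mulr0//; apply/eqP; lia.
  rewrite (eE _ (lt1 k0)) (eE _ (lt2 k0)) -jE eqxx ifN; last by apply/eqP; lia.
  have -> : j.-1 = (d + 2 * k0)%N by lia.
  by rewrite mulr0 subr0 addr0.
have j1 : (j.-1 < d + 2 * n)%N by lia.
rewrite !mulE// eqxx ifN; last by apply/eqP; lia.
by field.
Qed.

Definition bounded_support (f : rvect R (d + 2 * n) -> R) :=
  exists M : R, forall p, 0 < f p ->
    (forall i, `|(tnth p.1 i : R)| <= M) /\ `|(p.2 : R)| <= M.

Definition bounded_density : set (density (@lebesgue_rvect R (d + 2 * n))) :=
  [set f | bounded_fun f /\ bounded_support f].

(* The Radon-Nikodym derivative is only determined almost everywhere; it may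
   be negative on a null set. *)
Definition corank1_density alpha j (f : density (@lebesgue_rvect R (d + 2 * n)))
    (y : rvect R (d + 2 * n).-1) : R :=
  fine (Radon_Nikodym
    (charge_of_finite_measure (distribution (density_law f) (corank1_proj alpha j)))
    (@lebesgue_rvect R (d + 2 * n).-1) y).

End corank1.

(* Main.v *)
Require Import Defs.
From HB Require Import structures.
From mathcomp Require Import all_boot all_order all_algebra.
From mathcomp Require Import all_classical all_reals all_analysis.
From mathcomp Require Import measurable_realfun.
From mathcomp Require Import zify ring lra.
Import Order.TTheory GRing.Theory Num.Theory.
Import numFieldNormedType.Exports.

(** The equivalence is an instance of the duality between functional
    inequalities of Brascamp-Lieb type and subadditivity of the entropy, and both
    directions rest on [ln s <= s - 1]. For a density [f] with marginals [g j]
    along maps [pi j], put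
    [deficit x = f x * ln (f x) - \sum_j c j * (f x * ln (g j (pi j x)))].
    Its integral is [S(f) - \sum_j c j * S(g j)], because integrating a function
    of [pi j x] against [f] is integrating it against [g j]
    ([integral_marginal]); so the entropy inequality says that this integral is
    at least [- D] ([entropy_le_deficitP]).

    If the functional inequality holds, it is tested on [g j `^ c j]. The product
    [F] of these functions composed with the [pi j] has integral at most
    [expR D], and Jensen's inequality for [ln (F / f)], in the form of the
    tangent inequality above, bounds the integral of the deficit below
    ([entropy_le_of_functional]).

    Conversely, given [phi j], let [F] be the product of the [phi j (pi j x)] and
    restrict it to a set [E N] that is bounded and on which every
    [phi j (pi j x)] lies between [N.+1^-1] and [N.+1]. After division by its
    integral [Z] it becomes a bounded density [f] with bounded support, to which
    the entropy inequality applies. On [E N], [ln f] is the sum of the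
    [c j * ln (h j (pi j x))] minus [ln Z], with [h j = phi j `^ (c j)^-1], and
    the relative entropy of [g j] with respect to [h j] is controlled by
    [ln (\int h j)] ([functional_of_entropy_density]). Exponentiating bounds [Z],
    and monotone convergence along [E N] removes the truncation
    ([functional_of_entropy]).

    All this needs finite entropies, and marginals that are absolutely
    continuous. Both follow from one geometric property, [bounded_fibers]:
    the part of a box lying over a set [A] has measure at most a constant times
    the measure of [A] intersected with another box. For the projections of the
    group it holds because each of them deletes a coordinate and then shears the
    last one: Fubini and translation invariance undo the shear
    ([lebesgue_rvect_slab], [corank1_bounded_fibers]). *)

Set Implicit Arguments.
Unset Strict Implicit.
Unset Printing Implicit Defensive.

Local Open Scope classical_set_scope.
Local Open Scope ring_scope.

(** * Logarithms *)

Lemma ln_le_subr1 (R : realType) (x : R) : 0 < x -> ln x <= x - 1.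
Proof.
move=> x0; have := expR_ge1Dx (ln x).
by rewrite lnK ?posrE//; lra.
Qed.

(** The upper bound comes from [ln x < x], the lower one from [ln s <= s - 1] at
    [s = x^-1]. Hence bounded densities living on sets of finite measure have
    finite entropy. *)
Lemma normr_mul_ln_le (R : realType) (M x : R) :
  0 <= x -> x <= M -> `|x * ln x| <= 1 + M ^+ 2.
Proof.
rewrite le_eqVlt => /predU1P[<- _|x0 xM].
  by rewrite mul0r normr0 addr_ge0// sqr_ge0.
have lnx : ln x <= x by rewrite ltW// ln_sublinear.
have lnV : - ln x <= x^-1 - 1.
  by rewrite -lnV ?posrE// ln_le_subr1// invr_gt0.
rewrite ler_norml; apply/andP; split.
  have : x * (- ln x) <= x * (x^-1 - 1) by rewrite ler_pM2l.
  by rewrite mulrBr mulfV ?gt_eqF// mulr1 mulrN; nra.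
have : x * ln x <= x * x by rewrite ler_pM2l.
by nra.
Qed.

Lemma ln_prod_powR (R : realType) (m : nat) (c b : 'I_m -> R) :
    (forall j, 0 < b j) ->
  ln (\prod_(j < m) b j `^ c j) = \sum_(j < m) c j * ln (b j).
Proof.
move=> b0.
suff : 0 < \prod_(j < m) b j `^ c j /\
    ln (\prod_(j < m) b j `^ c j) = \sum_(j < m) c j * ln (b j) by case.
elim/big_ind2 : _ => [|x1 x2 y1 y2 [x0 <-] [y0 <-]|j _].
- by rewrite ln1.
- by rewrite mulr_gt0// lnM.
- by rewrite powR_gt0// ln_powR.
Qed.

(** * Integrals and almost everywhere inequalities *)

Section ae_integral.
Local Open Scope ereal_scope.
Context d (T : measurableType d) (R : realType).
Variable mu : {measure set T -> \bar R}.

Lemma ae_le_integral (u v : T -> \bar R) :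
  mu.-integrable [set: T] u -> mu.-integrable [set: T] v ->
  {ae mu, forall x, u x <= v x} -> \int[mu]_x u x <= \int[mu]_x v x.
Proof.
move=> iu iv [N [mN N0 uvN]].
rewrite (negligible_integral mN _ iu N0)// (negligible_integral mN _ iv N0)//.
apply: le_integral.
- exact: measurableD.
- by apply: integrableS iu => //; exact: measurableD.
- by apply: integrableS iv => //; exact: measurableD.
- move=> x /set_mem[_ Nx]; apply: contrapT => uvx; exact: (Nx (uvN _ uvx)).
Qed.

Lemma ae_le_integrable (u v : T -> \bar R) :
  measurable_fun [set: T] u -> mu.-integrable [set: T] v ->
  {ae mu, forall x, `|u x| <= v x} -> mu.-integrable [set: T] u.
Proof.
move=> mu_ iv [N [mN N0 uvN]].
apply/(negligible_integrable mN _ mu_ N0) => //.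
apply: (@le_integrable _ _ _ _ _ _ _ v).
- exact: measurableD.
- exact: measurable_funS mu_.
- move=> x [_ Nx]; have : `|u x| <= v x.
    by apply: contrapT => uvx; exact: (Nx (uvN _ uvx)).
  by move=> /le_trans; apply; exact: lee_abs.
- by apply: integrableS iv => //; exact: measurableD.
Qed.

Lemma integrable_indicZ (B : set T) (r : R) : measurable B -> mu B < +oo ->
  mu.-integrable [set: T] (fun x => (r * \1_B x)%:E).
Proof.
move=> mB Boo; apply/integrableP; split.
  by apply/measurable_EFinP; exact: measurable_funM.
under eq_integral do
  rewrite abse_EFin normrM [X in (_ * X)%R]ger0_norm// EFinM.
rewrite ge0_integralZl_EFin//; last exact/measurable_EFinP.
by rewrite integral_indic// setIT lte_mul_pinfty// lee_fin.
Qed.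

(** Apply the hypothesis to the set where [v < u]: there [u - v] is positive
    with a nonpositive integral. *)
Lemma ae_le_from_integral (u v : T -> R) :
    mu.-integrable [set: T] (EFin \o u) ->
    mu.-integrable [set: T] (EFin \o v) ->
    (forall A, measurable A ->
      \int[mu]_(x in A) (u x)%:E <= \int[mu]_(x in A) (v x)%:E) ->
  {ae mu, forall x, (u x <= v x)%R}.
Proof.
move=> iu iv uv.
have mu_ : measurable_fun [set: T] u.
  exact/measurable_EFinP/measurable_int/iu.
have mv : measurable_fun [set: T] v.
  exact/measurable_EFinP/measurable_int/iv.
pose A := [set x | (v x < u x)%R].
have mA : measurable A.
  rewrite [A](_ : _ = [set: T] `&` (fun x => (v x < u x)%R) @^-1` [set true]).
    exact: measurable_fun_ltr.
  by rewrite setTI.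
have iuA : mu.-integrable A (EFin \o u) by exact: integrableS iu.
have ivA : mu.-integrable A (EFin \o v) by exact: integrableS iv.
have : \int[mu]_(x in A) `|(u x - v x)%:E| = 0.
  apply/eqP; rewrite eq_le; apply/andP; split; last exact: integral_ge0.
  under eq_integral => x xA.
    rewrite gee0_abs; last first.
      by move: xA; rewrite inE /A/= lee_fin subr_ge0 => /ltW.
    over.
  rewrite [X in X <= _](_ : _ =
    \int[mu]_(x in A) ((EFin \o u) \- (EFin \o v)) x)//.
  by rewrite integralB//= sube_le0; exact: uv.
have muv : measurable_fun A (fun x => (u x - v x)%:E).
  by apply/measurable_EFinP/measurable_funB;
    [exact: measurable_funTS mu_|exact: measurable_funTS mv].
move/(ae_eq_integral_abs mu mA muv) => [N [mN N0 AN]].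
exists N; split => // x /= /negP; rewrite -ltNge => vux; apply: AN => /=.
move=> /(_ vux)/= /eqP; rewrite eqe subr_eq0 => /eqP uvx.
by move: vux; rewrite uvx ltxx.
Qed.

End ae_integral.

(** * Integration against a density and its marginals *)

Section integral_density_law.
Local Open Scope ereal_scope.
Context d (T : measurableType d) (R : realType).
Variable mu : {sigma_finite_measure set T -> \bar R}.

Lemma integrable_density (f : density mu) :
  mu.-integrable [set: T] (EFin \o f).
Proof.
apply/integrableP; split; first exact/measurable_EFinP/density_measurable.
under eq_integral do rewrite gee0_abs ?lee_fin ?density_ge0//.
by rewrite density_int1 ltry.
Qed.

Lemma density_law_dominates (f : density mu) : density_law f `<< mu.
Proof.
apply/null_content_dominatesP => A mA A0.
rewrite /density_law null_set_integral//.
exact/measurable_funTS/measurable_EFinP/density_measurable.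
Qed.

(** A density agrees almost everywhere with the Radon-Nikodym derivative of its
    law, for which the change of measure is known. *)
Lemma ge0_integral_density_law (f : density mu) (phi : T -> \bar R) :
    measurable_fun [set: T] phi -> (forall x, 0 <= phi x) ->
  \int[density_law f]_x phi x = \int[mu]_x ((f x)%:E * phi x).
Proof.
move=> mphi phi0.
have fmu := density_law_dominates f.
rewrite -(Radon_Nikodym_SigmaFinite.change_of_variables fmu)//.
have mRN := Radon_Nikodym_SigmaFinite.f_integrable fmu.
apply: ae_eq_integral => //.
- by apply: emeasurable_funM => //; exact: measurable_int mRN.
- by apply: emeasurable_funM => //; exact/measurable_EFinP/density_measurable.
have : ae_eq mu [set: T] (EFin \o f)
    (Radon_Nikodym_SigmaFinite.f (density_law f) mu).
  apply: integral_ae_eq => //.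
  - exact: integrable_density.
  - exact: measurable_int mRN.
  - by move=> E _ mE; rewrite -Radon_Nikodym_SigmaFinite.f_integral.
by apply: filterS => x /= fE _; rewrite -fE// muleC.
Qed.

End integral_density_law.

Section marginal.
Local Open Scope ereal_scope.
Context d1 d2 (X : measurableType d1) (Y : measurableType d2) (R : realType).
Variables (mu : {sigma_finite_measure set X -> \bar R})
  (nu : {sigma_finite_measure set Y -> \bar R}).
Variable pi : X -> Y.
Hypothesis mpi : measurable_fun [set: X] pi.

Definition marginal (f : density mu) (g : density nu) :=
  forall A, measurable A -> density_law f (pi @^-1` A) = density_law g A.

Variables (f : density mu) (g : density nu).
Hypothesis fg : marginal f g.

Lemma ge0_integral_marginal (phi : Y -> \bar R) :
    measurable_fun [set: Y] phi -> (forall y, 0 <= phi y) ->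
  \int[mu]_x ((f x)%:E * phi (pi x)) = \int[nu]_y ((g y)%:E * phi y).
Proof.
move=> mphi phi0.
rewrite -[RHS]ge0_integral_density_law//.
have mphipi : measurable_fun [set: X] (phi \o pi) by exact: measurableT_comp.
rewrite -(ge0_integral_density_law f mphipi (fun x => phi0 (pi x))).
rewrite [RHS](eq_measure_integral (pushforward (density_law f) pi)); last first.
  by move=> A mA _; exact: esym (fg mA).
by rewrite ge0_integral_pushforward.
Qed.

(** The nonnegative case applies to the two parts of [phi], because [f] and [g]
    are nonnegative; an infinite part is then treated alike on both sides. *)
Lemma integral_marginal (phi : Y -> R) : measurable_fun [set: Y] phi ->
  \int[mu]_x (f x * phi (pi x))%:E = \int[nu]_y (g y * phi y)%:E.
Proof.
move=> mphi.
have pos (h r : R) : (0 <= h)%R -> maxe (h * r)%:E 0 = h%:E * maxe r%:E 0.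
  by move=> h0; rewrite maxe_pMr ?lee_fin// mule0 EFinM.
have neg (h r : R) : (0 <= h)%R ->
    maxe (- (h * r)%:E) 0 = h%:E * maxe (- r%:E) 0.
  by move=> h0; rewrite maxe_pMr ?lee_fin// mule0 EFinM muleN.
have mpos : measurable_fun [set: Y] (fun y => maxe (phi y)%:E 0).
  by apply: measurable_maxe => //; exact/measurable_EFinP.
have mneg : measurable_fun [set: Y] (fun y => maxe (- (phi y)%:E) 0).
  by apply: measurable_maxe => //; apply: measurableT_comp => //;
    exact/measurable_EFinP.
rewrite integralE [RHS]integralE; congr (_ - _).
- under eq_integral do rewrite funeposE pos ?density_ge0//.
  under [RHS]eq_integral do rewrite funeposE pos ?density_ge0//.
  by rewrite (ge0_integral_marginal mpos)// => y; rewrite le_max lexx orbT.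
- under eq_integral do rewrite funenegE neg ?density_ge0//.
  under [RHS]eq_integral do rewrite funenegE neg ?density_ge0//.
  by rewrite (ge0_integral_marginal mneg)// => y; rewrite le_max lexx orbT.
Qed.

Lemma integrable_marginal (phi : Y -> R) : measurable_fun [set: Y] phi ->
  nu.-integrable [set: Y] (fun y => (g y * phi y)%:E) ->
  mu.-integrable [set: X] (fun x => (f x * phi (pi x))%:E).
Proof.
move=> mphi /integrableP[_ goo]; apply/integrableP; split.
  apply/measurable_EFinP/measurable_funM; first exact: density_measurable.
  exact: measurableT_comp.
apply: le_lt_trans goo; rewrite le_eqVlt; apply/orP; left; apply/eqP.
under eq_integral do rewrite abse_EFin normrM ger0_norm ?density_ge0//.
under [RHS]eq_integral do rewrite abse_EFin normrM ger0_norm ?density_ge0//.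
rewrite (integral_marginal (phi := fun y => `|phi y|%R))//.
exact: measurableT_comp.
Qed.

(** The event [g = 0] has probability 0 under the law with density [g], hence its
    preimage is null for the law with density [f]. This makes [ln (g (pi x))]
    meaningful wherever [f] charges. *)
Lemma marginal_gt0 : {ae mu, forall x, (0 < f x)%R -> (0 < g (pi x))%R}.
Proof.
pose A := [set y | g y = 0%R].
have mg := density_measurable g; have mf := density_measurable f.
have mA : measurable A.
  by rewrite -[A]setTI; exact: (mg measurableT _ (measurable_set1 0%R)).
have mB : measurable (pi @^-1` A).
  by rewrite -[X in measurable X]setTI; exact: mpi.
have : \int[mu]_(x in pi @^-1` A) `|(f x)%:E| = 0.
  under eq_integral do rewrite gee0_abs ?lee_fin ?density_ge0//.
  rewrite -/(density_law f _) fg// /density_law.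
  by rewrite integral0_eq// => y ->.
have mfB : measurable_fun (pi @^-1` A) (EFin \o f).
  exact/measurable_funTS/measurable_EFinP.
move/(ae_eq_integral_abs mu mB mfB); apply: filterS => x /= fx0 fx.
rewrite lt_neqAle density_ge0 andbT eq_sym; apply/eqP => gx.
by move: (fx0 gx) => -[fE]; rewrite fE ltxx in fx.
Qed.

End marginal.

Section integral_lincomb.
Local Open Scope ereal_scope.
Context d (T : measurableType d) (R : realType).
Variable mu : {measure set T -> \bar R}.
Variables (m : nat) (a : R) (u : T -> R) (c : 'I_m -> R) (w : 'I_m -> T -> R).
Hypothesis iu : mu.-integrable [set: T] (EFin \o u).
Hypothesis iw : forall j, mu.-integrable [set: T] (EFin \o w j).

Let lincombE : (fun x => (a * u x + \sum_(j < m) c j * w j x)%:E) =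
  (fun x => a%:E * (u x)%:E) \+ (fun x => \sum_(j < m) (c j)%:E * (w j x)%:E).
Proof.
apply/funext => x /=; rewrite EFinD EFinM -sumEFin.
by under [in RHS]eq_bigr do rewrite -EFinM.
Qed.

Lemma integrable_lincomb :
  mu.-integrable [set: T] (fun x => (a * u x + \sum_(j < m) c j * w j x)%:E).
Proof.
rewrite lincombE; apply: integrableD => //; first exact: integrableZl.
apply: integrable_sum => // j _.
exact: (integrableZl measurableT (c j) (iw j)).
Qed.

Lemma integral_lincomb :
  \int[mu]_x (a * u x + \sum_(j < m) c j * w j x)%:E =
  a%:E * \int[mu]_x (u x)%:E + \sum_(j < m) (c j)%:E * \int[mu]_x (w j x)%:E.
Proof.
have ic j : mu.-integrable [set: T] (fun x => (c j)%:E * (w j x)%:E).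
  exact: (integrableZl measurableT (c j) (iw j)).
rewrite lincombE integralD//; last 2 first.
- exact: integrableZl.
- by apply: integrable_sum => // j _; exact: ic.
rewrite integralZl// (integral_sum measurableT ic).
by congr (_ + _); apply: eq_bigr => j _; rewrite (integralZl measurableT (iw j)).
Qed.

End integral_lincomb.

(** * Finiteness of the entropies *)

Section entropy_integrable.
Local Open Scope ereal_scope.
Context d1 d2 (X : measurableType d1) (Y : measurableType d2) (R : realType).
Variables (mu : {sigma_finite_measure set X -> \bar R})
  (nu : {sigma_finite_measure set Y -> \bar R}).

Lemma measurable_mul_ln d (T : measurableType d) (g : T -> R) :
  measurable_fun [set: T] g ->
  measurable_fun [set: T] (fun x => g x * ln (g x))%R.
Proof.
move=> mg; apply: measurable_funM => //.
exact: (measurableT_comp (@measurable_ln R)).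
Qed.

Lemma integrable_mul_ln (g : density nu) (M : R) (B : set Y) :
    measurable B -> nu B < +oo ->
    {ae nu, forall y, (g y <= M * \1_B y)%R} ->
  nu.-integrable [set: Y] (fun y => (g y * ln (g y))%:E).
Proof.
move=> mB Boo gM.
apply: (ae_le_integrable _ (integrable_indicZ (1 + M ^+ 2) mB Boo)).
  exact/measurable_EFinP/measurable_mul_ln/density_measurable.
apply: filterS gM => y gM; rewrite abse_EFin lee_fin.
have := density_ge0 g y; move: gM; rewrite indicE; case: (y \in B) => /=.
  by rewrite !mulr1 => gM g0; exact: normr_mul_ln_le.
rewrite !mulr0 => gy0 g0.
by have -> : g y = 0%R by [apply/eqP; rewrite eq_le gy0]; rewrite mul0r normr0.
Qed.

Variable pi : X -> Y.
Hypothesis mpi : measurable_fun [set: X] pi.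

(** Informally, each fiber of [pi] meets [K] in a set of size at most [C], and
    [pi] maps [K] into a set [B] of finite measure. The condition compares
    measures of sets instead of fibers, so that it makes sense without
    disintegrating [mu] along [pi]. *)
Definition bounded_fibers (K : set X) := exists C : R, exists B : set Y,
  [/\ measurable B, nu B < +oo &
      forall A, measurable A -> mu (K `&` pi @^-1` A) <= C%:E * nu (A `&` B)].

(** A bounded density supported in [K] has a bounded marginal that vanishes
    off [B]: the probability of [pi @^-1` A] is at most
    [M * mu (K & pi @^-1` A)]. *)
Lemma marginal_le (f : density mu) (g : density nu) (K : set X) (M : R) :
    measurable K -> bounded_fibers K -> marginal pi f g ->
    (forall x, f x <= M)%R -> (forall x, 0 < f x -> K x)%R ->
  exists M' : R, exists B : set Y, [/\ measurable B, nu B < +oo &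
    {ae nu, forall y, (g y <= M' * \1_B y)%R}].
Proof.
move=> mK [C [B [mB Boo KB]]] fg fM fK; exists (`|M| * `|C|)%R, B; split => //.
apply: ae_le_from_integral.
- exact: integrable_density.
- exact: integrable_indicZ.
move=> A mA; rewrite -/(density_law g A) -(fg A mA) /density_law.
have mpA : measurable (pi @^-1` A).
  by rewrite -[X in measurable X]setTI; exact: mpi.
have mfA : measurable_fun (pi @^-1` A) (EFin \o f).
  exact/measurable_funTS/measurable_EFinP/density_measurable.
apply: (@le_trans _ _ (\int[mu]_(x in pi @^-1` A) (`|M|%:E * (\1_K x)%:E))).
  apply: ge0_le_integral => //.
  - by move=> x _; rewrite lee_fin density_ge0.
  - by apply: emeasurable_funM => //; exact/measurable_EFinP.
  - move=> x _; rewrite -EFinM lee_fin indicE.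
    case: (boolP (x \in K)) => [|/negP] xK.
      by rewrite mulr1 (le_trans (fM x))// ler_norm.
    rewrite mulr0 leNgt; apply/negP => /fK Kx; apply: xK; exact/mem_set.
rewrite ge0_integralZl_EFin//; last exact/measurable_EFinP.
rewrite integral_indic//.
have -> : \int[nu]_(x in A) (`|M| * `|C| * \1_B x)%:E =
    `|M|%:E * (`|C|%:E * nu (A `&` B)).
  under eq_integral do rewrite EFinM.
  rewrite ge0_integralZl_EFin//; last exact/measurable_EFinP.
  by rewrite integral_indic// EFinM -muleA [B `&` A]setIC.
rewrite lee_wpmul2l ?lee_fin//; apply: le_trans (KB A mA) _.
by rewrite lee_wpmul2r// lee_fin ler_norm.
Qed.

End entropy_integrable.

(** * Duality at a fixed density *)

Section duality.
Local Open Scope ereal_scope.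
Context d1 d2 (X : measurableType d1) (Y : measurableType d2) (R : realType).
Variables (mu : {sigma_finite_measure set X -> \bar R})
  (nu : {sigma_finite_measure set Y -> \bar R}).
Variables (m : nat) (pi : 'I_m -> X -> Y).
Hypothesis mpi : forall j, measurable_fun [set: X] (pi j).
Variables (c : 'I_m -> R) (D : R).

Section fixed_density.
Variables (f : density mu) (g : 'I_m -> density nu).
Hypothesis fg : forall j, marginal (pi j) f (g j).
Hypothesis ilnf : mu.-integrable [set: X] (fun x => (f x * ln (f x))%:E).
Hypothesis ilng : forall j,
  nu.-integrable [set: Y] (fun y => (g j y * ln (g j y))%:E).

(** Its integral is [S(f) - \sum_j c j * S(g j)], where the entropies of the
    marginals have been pulled back to [X]: this turns an inequality between
    integrals over different spaces into a pointwise one. The factor 1 makes it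
    an instance of [integral_lincomb]. *)
Definition entropy_deficit (x : X) : R :=
  (1 * (f x * ln (f x)) + \sum_(j < m) - c j * (f x * ln (g j (pi j x))))%R.

Let measurable_lng j : measurable_fun [set: Y] (fun y => ln (g j y)).
Proof.
by apply: (measurableT_comp (@measurable_ln R)); exact: density_measurable.
Qed.

Let ifg j : mu.-integrable [set: X] (fun x => (f x * ln (g j (pi j x)))%:E).
Proof.
exact: (integrable_marginal (mpi j) (@fg j) (measurable_lng j) (ilng j)).
Qed.

Lemma integrable_deficit : mu.-integrable [set: X] (EFin \o entropy_deficit).
Proof. exact: (integrable_lincomb 1 (fun j => - c j)%R ilnf ifg). Qed.

Lemma integral_deficit : \int[mu]_x (entropy_deficit x)%:E =
  entropy mu f - \sum_(j < m) (c j)%:E * entropy nu (g j).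
Proof.
rewrite (integral_lincomb 1 (fun j => - c j)%R ilnf ifg) mul1e; congr (_ + _).
rewrite -sumeN; last first.
  move=> i j _ _; apply: fin_num_adde_defl.
  by rewrite fin_numM//; exact: (integrable_fin_num measurableT (ilng _)).
apply: eq_bigr => j _; rewrite EFinN mulNe; congr (- (_ * _)).
by rewrite (integral_marginal (mpi j) (@fg j) (measurable_lng j)).
Qed.

Lemma entropy_le_deficitP :
  \sum_(j < m) (c j)%:E * entropy nu (g j) <= entropy mu f + D%:E <->
  - D%:E <= \int[mu]_x (entropy_deficit x)%:E.
Proof.
rewrite integral_deficit.
have fS : entropy mu f \is a fin_num.
  exact: (integrable_fin_num measurableT ilnf).
have fT : \sum_(j < m) (c j)%:E * entropy nu (g j) \is a fin_num.
  apply/sum_fin_numP => j _ _; rewrite fin_numM//.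
  exact: (integrable_fin_num measurableT (ilng j)).
rewrite -(fineK fS) -(fineK fT) -EFinD -EFinN -EFinB !lee_fin.
by split; lra.
Qed.

Let all_gt0 : {ae mu, forall x, forall j, (0 < f x)%R -> (0 < g j (pi j x))%R}.
Proof.
by apply: filter_forall => j; exact: (marginal_gt0 (mpi j) (@fg j)).
Qed.

(** Test the functional inequality on the powers [g j `^ c j], whose right-hand
    side is [expR D] because the [g j] have integral 1. With [F] the product of
    the [g j (pi j x) `^ c j], the bound [ln s <= s - 1] at
    [s = expR (- D) * F / f] gives [(1 - D) * f - expR (- D) * F] as a pointwise
    lower bound of the deficit, and its integral is at least [- D]. *)
Lemma entropy_le_of_functional :
    \int[mu]_x (\prod_(j < m) (g j (pi j x)) `^ c j)%:E <= (expR D)%:E ->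
  \sum_(j < m) (c j)%:E * entropy nu (g j) <= entropy mu f + D%:E.
Proof.
set F := fun x => (\prod_(j < m) (g j (pi j x)) `^ c j)%R => FD.
have F0 x : (0 <= F x)%R by apply: prodr_ge0 => j _; exact: powR_ge0.
have mF : measurable_fun [set: X] F.
  apply: measurable_prod => j _; apply: (measurableT_comp (measurable_powR _)).
  apply: measurableT_comp => //; exact: density_measurable.
have iF : mu.-integrable [set: X] (EFin \o F).
  apply/integrableP; split; first exact/measurable_EFinP.
  under eq_integral do rewrite gee0_abs ?lee_fin//.
  exact: le_lt_trans FD (ltry _).
apply/entropy_le_deficitP.
have iv := integrable_lincomb (1 - D) (fun _ : 'I_1 => - expR (- D))%R
  (integrable_density f) (fun _ => iF).
have := ae_le_integral iv integrable_deficit.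
rewrite (integral_lincomb _ _ (integrable_density f) (fun _ => iF)) density_int1.
rewrite big_ord1 mule1 => vu.
apply: le_trans (vu _).
  move: FD; rewrite -(fineK (integrable_fin_num measurableT iF)).
  rewrite -EFinM -EFinD -EFinN !lee_fin => FD.
  have : (expR (- D) * fine (\int[mu]_x (EFin \o F) x)%E <=
      expR (- D) * expR D)%R.
    by rewrite ler_pM2l ?expR_gt0.
  by rewrite -expRD addNr expR0; lra.
apply: filterS all_gt0 => x gx; rewrite lee_fin /entropy_deficit big_ord1 mul1r.
have := density_ge0 f x; rewrite le_eqVlt => /predU1P[fx|fx].
  rewrite -fx mulr0 mul0r big1 => [|j _]; last by rewrite mul0r mulr0.
  by rewrite !add0r mulNr oppr_le0 mulr_ge0 ?expR_ge0.
have g0 j : (0 < g j (pi j x))%R by exact: gx.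
have Fx : (0 < F x)%R by apply: prodr_gt0 => j _; exact: powR_gt0.
have -> : (\sum_(j < m) - c j * (f x * ln (g j (pi j x))) = - (f x * ln (F x)))%R.
  rewrite /F ln_prod_powR// mulr_sumr -sumrN.
  by apply: eq_bigr => j _; ring.
have : (ln (expR (- D) * F x / f x) <= expR (- D) * F x / f x - 1)%R.
  by rewrite ln_le_subr1// divr_gt0// mulr_gt0// expR_gt0.
rewrite ln_div ?posrE ?mulr_gt0 ?expR_gt0// lnM ?posrE ?expR_gt0// expRK.
move=> /(ler_wpM2l (ltW fx)).
rewrite [X in (_ <= X)%R -> _]mulrBr [X in (_ <= X - _)%R -> _]mulrC.
by rewrite divfK ?gt_eqF//; lra.
Qed.

(** Here [h j] stands for [phi j `^ (c j)^-1], so that [f] is the normalized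
    integrand [Z^-1 * \prod_j phi j (pi j x)], restricted to some set. Then [ln f]
    is a combination of the [ln (h j)], and [ln w <= w - 1] at
    [w = h j / (g j * I j)] bounds each relative entropy
    [\int f * ln (h j / g j)] by [ln (I j)], since [\int g j * w] is at most 1. *)
Lemma functional_of_entropy_density (h : 'I_m -> Y -> R) (I : 'I_m -> R)
    (Z : R) :
    (forall j, 0 <= c j)%R -> (0 < Z)%R -> (forall j, 0 < I j)%R ->
    (forall j, measurable_fun [set: Y] (h j)) -> (forall j y, 0 <= h j y)%R ->
    (forall j, \int[nu]_y (h j y)%:E = (I j)%:E) ->
    (forall x, 0 < f x -> (forall j, 0 < h j (pi j x)) /\
      f x = Z^-1 * \prod_(j < m) (h j (pi j x)) `^ c j)%R ->
    \sum_(j < m) (c j)%:E * entropy nu (g j) <= entropy mu f + D%:E ->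
  (Z <= expR D * \prod_(j < m) (I j) `^ c j)%R.
Proof.
move=> c0 Z0 I0 mh h0 hI fh /entropy_le_deficitP uD.
pose w j y := (h j y / (g j y * I j))%R.
have mg j : measurable_fun [set: Y] (g j) by exact: density_measurable.
have w0 j y : (0 <= w j y)%R.
  by rewrite /w divr_ge0// mulr_ge0 ?density_ge0// ltW.
have mw j : measurable_fun [set: Y] (w j).
  rewrite (_ : w j = (fun y => h j y * (g j y * I j) `^ (- 1))%R).
    apply: measurable_funM => //.
    by apply: (measurableT_comp (measurable_powR _)); exact: measurable_funM.
  by apply/funext => y; rewrite powR_inv1// mulr_ge0 ?density_ge0// ltW.
have gw1 j : \int[nu]_y (g j y * w j y)%:E <= 1.
  have h0j y : [set: Y] y -> 0 <= (h j y)%:E by rewrite lee_fin.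
  have -> : 1 = \int[nu]_y ((I j)^-1%:E * (h j y)%:E).
    rewrite ge0_integralZl_EFin ?hI//; last 2 first.
    - exact/measurable_EFinP.
    - by rewrite invr_ge0 ltW.
    by rewrite -EFinM mulVf// gt_eqF.
  apply: ge0_le_integral => //.
  - by move=> y _; rewrite lee_fin mulr_ge0// density_ge0.
  - by apply/measurable_EFinP; exact: measurable_funM.
  - by apply: measurable_funeM; exact/measurable_EFinP.
  - move=> y _; rewrite -EFinM lee_fin /w.
    have := density_ge0 (g j) y; rewrite le_eqVlt => /predU1P[<-|gy].
      by rewrite mul0r mulr_ge0// invr_ge0 ltW.
    by rewrite le_eqVlt; apply/orP; left; apply/eqP; field; rewrite !gt_eqF.
have ifw j : mu.-integrable [set: X] (fun x => (f x * w j (pi j x))%:E).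
  apply: (integrable_marginal (mpi j) (@fg j) (mw j)).
  apply/integrableP; split.
    by apply/measurable_EFinP; exact: measurable_funM.
  have gw0 y : (0 <= g j y * w j y)%R by rewrite mulr_ge0// density_ge0.
  under eq_integral do rewrite gee0_abs ?lee_fin ?gw0//.
  exact: le_lt_trans (gw1 j) (ltry _).
pose k := (\sum_(j < m) c j * (ln (I j) - 1) - ln Z)%R.
have iv := integrable_lincomb k c (integrable_density f) ifw.
have := ae_le_integral integrable_deficit iv.
rewrite (integral_lincomb _ _ (integrable_density f) ifw) density_int1 mule1.
move=> uv; have {}uv : - D%:E <= k%:E + \sum_(j < m) (c j)%:E *
    \int[mu]_x (f x * w j (pi j x))%:E.
  apply: (le_trans uD); apply: uv.
  apply: filterS all_gt0 => x gx; rewrite lee_fin /entropy_deficit mul1r.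
  have := density_ge0 f x; rewrite le_eqVlt => /predU1P[fx|fx].
    rewrite -fx mulr0 mul0r !big1// => j _; last by rewrite mul0r mulr0.
    by rewrite mul0r mulr0.
  have [hx fE] := fh _ fx.
  have g0 j : (0 < g j (pi j x))%R by exact: gx.
  have -> : ln (f x) = (\sum_(j < m) c j * ln (h j (pi j x)) - ln Z)%R.
    rewrite fE lnM ?posrE ?invr_gt0//; last first.
      by apply: prodr_gt0 => j _; exact: powR_gt0.
    by rewrite lnV ?posrE// ln_prod_powR// addrC.
  rewrite /k !mulrBl mulrBr [X in (_ <= X)%R]addrAC [X in (X <= _)%R]addrAC.
  rewrite [X in (_ - X <= _)%R]mulrC lerD2r.
  rewrite mulr_sumr mulr_suml -!big_split/=; apply: ler_sum => j _.
  have wE : w j (pi j x) = (h j (pi j x) / (g j (pi j x) * I j))%R by [].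
  have : (ln (w j (pi j x)) <= w j (pi j x) - 1)%R.
    by rewrite ln_le_subr1// wE divr_gt0// mulr_gt0.
  rewrite {1}wE ln_div ?posrE ?mulr_gt0// lnM ?posrE// => lnw.
  have : (c j * f x * (ln (h j (pi j x)) - (ln (g j (pi j x)) + ln (I j))) <=
      c j * f x * (w j (pi j x) - 1))%R.
    by rewrite ler_wpM2l// mulr_ge0// ltW.
  by lra.
have {}uv : - D%:E <= k%:E + \sum_(j < m) (c j)%:E.
  apply: (le_trans uv); rewrite leeD2l//; apply: lee_sum => j _.
  rewrite (integral_marginal (mpi j) (@fg j) (mw j)) -[leRHS]mule1.
  by rewrite lee_wpmul2l// lee_fin.
rewrite sumEFin -EFinD -EFinN lee_fin /k in uv.
rewrite -ler_ln ?posrE//; last first.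
  by rewrite mulr_gt0 ?expR_gt0//; apply: prodr_gt0 => j _; exact: powR_gt0.
rewrite lnM ?posrE ?expR_gt0//; last first.
  by apply: prodr_gt0 => j _; exact: powR_gt0.
rewrite expRK ln_prod_powR//.
have : (\sum_(j < m) c j * (ln (I j) - 1) =
    \sum_(j < m) c j * ln (I j) - \sum_(j < m) c j)%R.
  by rewrite -sumrB; apply: eq_bigr => j _; ring.
by lra.
Qed.

End fixed_density.
End duality.

(** * From the entropy inequality to the functional inequality *)

Section exhaustion.
Local Open Scope ereal_scope.
Context d1 d2 (X : measurableType d1) (Y : measurableType d2) (R : realType).
Variables (mu : {sigma_finite_measure set X -> \bar R})
  (nu : {sigma_finite_measure set Y -> \bar R}).
Variables (m : nat) (pi : 'I_m -> X -> Y).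
Hypothesis mpi : forall j, measurable_fun [set: X] (pi j).
Variable K : nat -> set X.
Hypothesis mK : forall N, measurable (K N).
Hypothesis Koo : forall N, mu (K N) < +oo.
Hypothesis ndK : nondecreasing_seq K.
Hypothesis KT : \bigcup_N K N = [set: X].
Hypothesis fiberK : forall j N, bounded_fibers mu nu (pi j) (K N).

Definition bounded_supported (f : X -> R) :=
  (exists M : R, forall x, (f x <= M)%R) /\
  (exists N, forall x, (0 < f x)%R -> K N x).

Lemma integrable_entropy (f : density mu) : bounded_supported f ->
  mu.-integrable [set: X] (fun x => (f x * ln (f x))%:E).
Proof.
move=> [[M fM] [N fK]]; apply: (@integrable_mul_ln _ _ _ _ f M (K N)) => //.
apply: aeW => x; rewrite indicE; case: (boolP (x \in K N)) => [|/negP] xK.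
  by rewrite mulr1.
by rewrite mulr0 leNgt; apply/negP => /fK Kx; apply: xK; exact/mem_set.
Qed.

Lemma integrable_entropy_marginal j (f : density mu) (g : density nu) :
    bounded_supported f -> marginal (pi j) f g ->
  nu.-integrable [set: Y] (fun y => (g y * ln (g y))%:E).
Proof.
move=> [[M fM] [N fK]] fg.
have [M' [B [mB Boo gB]]] := marginal_le (mpi j) (mK N) (fiberK j N) fg fM fK.
exact: (integrable_mul_ln mB Boo gB).
Qed.

Lemma preimage_null j (A : set Y) : measurable A -> nu A = 0 ->
  mu (pi j @^-1` A) = 0.
Proof.
move=> mA A0.
have mpA : measurable (pi j @^-1` A).
  by rewrite -[X in measurable X]setTI; exact: mpi.
apply/(negligibleP _ mpA).1; rewrite -[pi j @^-1` A]setTI -KT setI_bigcupl.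
apply: negligible_bigcup => N; apply/negligibleP; first exact: measurableI.
have [C [B [mB _ KB]]] := fiberK j N.
apply/eqP; rewrite -measure_le0; apply: le_trans (KB A mA) _.
rewrite (_ : nu (A `&` B) = 0) ?mule0//.
by apply: (subset_measure0 _ _ _ A0) => //; exact: measurableI.
Qed.

Variables (c : 'I_m -> R) (D : R).
Hypothesis c_gt0 : forall j, (0 < c j)%R.

Section functional.
Variable phi : 'I_m -> Y -> R.
Hypothesis mphi : forall j, measurable_fun [set: Y] (phi j).
Hypothesis phi0 : forall j y, (0 <= phi j y)%R.

Let F x := (\prod_(j < m) phi j (pi j x))%R.

Let F0 x : (0 <= F x)%R. Proof. exact: prodr_ge0. Qed.

Let mphipi j : measurable_fun [set: X] (fun x => phi j (pi j x)).
Proof. exact: measurableT_comp. Qed.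

Let mF : measurable_fun [set: X] F.
Proof. by apply: measurable_prod => j _; exact: mphipi. Qed.

Let h j y := (phi j y `^ (c j)^-1)%R.

Let mh j : measurable_fun [set: Y] (h j).
Proof. exact: (measurableT_comp (measurable_powR _)). Qed.

(** If [h j] vanishes almost everywhere, so does [h j \o pi j], because preimages
    of null sets are null. *)
Lemma integral_prod_null j : \int[nu]_y (h j y)%:E = 0 -> \int[mu]_x (F x)%:E = 0.
Proof.
move=> hj0.
have mhE : measurable_fun [set: Y] (EFin \o h j) by exact/measurable_EFinP.
have [N [mN N0 hN]] : ae_eq nu [set: Y] (EFin \o h j) (cst 0).
  apply/(ae_eq_integral_abs nu measurableT mhE); rewrite -[RHS]hj0.
  by apply: eq_integral => y _; rewrite gee0_abs// lee_fin powR_ge0.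
have mFE : measurable_fun [set: X] (EFin \o F) by exact/measurable_EFinP.
transitivity (\int[mu]_x `|(F x)%:E|).
  by apply: eq_integral => x _; rewrite gee0_abs// lee_fin.
apply/(ae_eq_integral_abs mu measurableT mFE).
exists (pi j @^-1` N); split.
- by rewrite -[X in measurable X]setTI; exact: mpi.
- exact: preimage_null.
- move=> x /= Fx; apply: hN => /= hx; apply: Fx => _; congr EFin.
  have /(congr1 fine)/= /powR_eq0_eq0 phix := hx Logic.I.
  by apply/eqP; rewrite /F (bigD1 j)//= phix mul0r.
Qed.

(* On [good N] every logarithm [ln (phi j (pi j x))] is bounded, so no
   integrability question arises; these sets exhaust the set where the
   integrand is positive. *)
Let good N := [set x | forall j, (N.+1%:R^-1 <= phi j (pi j x) <= N.+1%:R)%R].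

Let mgood N : measurable (good N).
Proof.
rewrite (_ : good N = \bigcap_(j in [set: 'I_m])
    ((fun x => phi j (pi j x)) @^-1` `[N.+1%:R^-1%R, N.+1%:R%R]%classic)).
  apply: fin_bigcap_measurable => // j _.
  by rewrite -[X in measurable X]setTI; exact: mphipi.
apply/seteqP; split => x /= gx j; have := gx j; rewrite /= in_itv/=.
  by move=> + _.
exact.
Qed.

Let E N := K N `&` good N.

Let mE N : measurable (E N). Proof. exact: measurableI. Qed.

Let ndE : nondecreasing_seq E.
Proof.
move=> N N' NN'; apply/subsetPset => x [KNx gx]; split.
  by move: x KNx {gx}; exact/subsetPset/ndK.
move=> j; have /andP[l u] := gx j; apply/andP; split.
  by apply: le_trans l; rewrite lef_pV2 ?posrE// ler_nat.
by apply: (le_trans u); rewrite ler_nat.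
Qed.

Let bigcupE x : (\bigcup_N E N) x <-> (0 < F x)%R.
Proof.
split=> [[N _ [_ gx]]|Fx].
  apply: prodr_gt0 => j _; have /andP[l _] := gx j.
  by apply: lt_le_trans l; rewrite invr_gt0.
have phix j : (0 < phi j (pi j x))%R.
  rewrite lt_neqAle phi0 andbT eq_sym; apply/eqP => p0.
  by move: Fx; rewrite /F (bigD1 j)//= p0 mul0r ltxx.
have [N0 _ KN0] : (\bigcup_N K N) x by rewrite KT.
suff : \forall N \near \oo, E N x.
  by case=> N _ /(_ N (leqnn N)) EN; exists N.
have inv0 : (fun N => N.+1%:R^-1 : R)%R @ \oo --> 0%R by exact: cvg_harmonic.
near=> N; split; near: N.
  by exists N0 => // N /= NN0; move: x KN0 {Fx phix}; exact/subsetPset/ndK.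
apply: filter_forall => j; near=> N; apply/andP; split.
  by apply: ltW; near: N; exact: (cvgr_lt _ inv0 _ (phix j)).
apply: (@le_trans _ _ N%:R); last by rewrite ler_nat.
by near: N; exact: nbhs_infty_ger.
Unshelve. all: by end_near. Qed.


Hypothesis entropy_ineq : forall f : density mu, bounded_supported f ->
  exists g : 'I_m -> density nu, (forall j, marginal (pi j) f (g j)) /\
    \sum_(j < m) (c j)%:E * entropy nu (g j) <= entropy mu f + D%:E.

Let integral_good_le (I : 'I_m -> R) N : (forall j, 0 < I j)%R ->
    (forall j, \int[nu]_y (h j y)%:E = (I j)%:E) ->
  \int[mu]_(x in E N) (F x)%:E <= (expR D * \prod_(j < m) (I j) `^ c j)%:E.
Proof.
move=> I0 hI.
have FN x : E N x -> (F x <= N.+1%:R ^+ m)%R.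
  move=> [_ gx]; rewrite /F -[X in (_ ^+ X)%R]card_ord -prodr_const.
  by apply: ler_prod => j _; rewrite phi0; have /andP[] := gx j.
have mFE : measurable_fun (E N) (EFin \o F).
  exact/measurable_funTS/measurable_EFinP.
have Zoo : \int[mu]_(x in E N) (F x)%:E < +oo.
  apply: (@le_lt_trans _ _ (\int[mu]_(x in E N) (N.+1%:R ^+ m)%:E)).
    by apply: ge0_le_integral => // x _; rewrite lee_fin.
  rewrite (integral_cst mu (mE N)) lte_mul_pinfty ?lee_fin ?exprn_ge0//.
  apply: le_lt_trans (Koo N); apply: le_measure; rewrite ?inE//.
  exact: subIsetl.
have Zge0 : 0 <= \int[mu]_(x in E N) (F x)%:E.
  by apply: integral_ge0 => x _; rewrite lee_fin.
have /fineK ZE : \int[mu]_(x in E N) (F x)%:E \is a fin_num.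
  by rewrite ge0_fin_numE.
rewrite -ZE lee_fin; set Z := fine _ in ZE *.
have := Zge0; rewrite -ZE lee_fin le_eqVlt => /predU1P[<-|Z0].
  by rewrite mulr_ge0 ?expR_ge0// prodr_ge0// => j _; exact: powR_ge0.
pose f0 x := (Z^-1 * F x * \1_(E N) x)%R.
have mf0 : measurable_fun [set: X] f0.
  by apply: measurable_funM => //; exact: measurable_funM.
have f0_ge0 x : (0 <= f0 x)%R by rewrite !mulr_ge0// invr_ge0 ltW.
have f0_int1 : \int[mu]_x (f0 x)%:E = 1.
  transitivity (\int[mu]_(x in E N) (Z^-1%:E * (F x)%:E)).
    rewrite [RHS]integral_mkcond; apply: eq_integral => x _.
    rewrite patchE /f0 indicE; case: ifP => _.
      by rewrite mulr1 EFinM.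
    by rewrite mulr0.
  rewrite ge0_integralZl_EFin//; last 2 first.
  - by move=> x _; rewrite lee_fin.
  - by rewrite invr_ge0 ltW.
  by rewrite -ZE -EFinM mulVf// gt_eqF.
pose f := Density mf0 f0_ge0 f0_int1.
have f0E x : (0 < f x)%R -> E N x.
  rewrite /= /f0 indicE; case: (boolP (x \in E N)) => [xE _|_].
    exact: set_mem.
  by rewrite mulr0 ltxx.
have bf : bounded_supported f.
  split; last by exists N => x /f0E[].
  exists (Z^-1 * N.+1%:R ^+ m)%R => x /=; rewrite /f0 indicE.
  case: (boolP (x \in E N)) => [/set_mem xE|_] /=.
    by rewrite mulr1 ler_pM2l ?invr_gt0// FN.
  by rewrite mulr0 mulr_ge0 ?invr_ge0 ?(ltW Z0)// exprn_ge0.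
have [g [fg gD]] := entropy_ineq bf.
apply: (functional_of_entropy_density mpi fg (integrable_entropy bf)
  (fun j => integrable_entropy_marginal bf (fg j)) _ Z0 I0 mh _ hI _ gD).
- by move=> j; exact: ltW.
- by move=> j y; exact: powR_ge0.
- move=> x /f0E xE; split=> [j|].
    apply: powR_gt0; have [_ /(_ j) /andP[l _]] := xE.
    by apply: lt_le_trans l; rewrite invr_gt0.
  rewrite /= /f0 indicE mem_set// mulr1; congr (_ * _)%R.
  apply: eq_bigr => j _; rewrite /h -powRrM mulVf ?gt_eqF//.
  by rewrite powRr1.
Qed.

(** When every [\int h j] is positive and finite, monotone convergence along
    [E N] reduces to the normalized truncated integrand. Otherwise one integral
    is 0, and the left-hand side vanishes, or all are positive and one is
    infinite, and the right-hand side is infinite. *)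
Lemma functional_of_entropy : \int[mu]_x (\prod_(j < m) phi j (pi j x))%:E <=
  (expR D)%:E * \prod_(j < m) (\int[nu]_y (phi j y `^ (c j)^-1)%:E) `^ c j.
Proof.
have h0 j : 0 <= \int[nu]_y (h j y)%:E.
  by apply: integral_ge0 => y _; rewrite lee_fin powR_ge0.
have [[j hj0]|/forallNP hn0] := pselect (exists j, \int[nu]_y (h j y)%:E = 0).
  rewrite (integral_prod_null hj0) mule_ge0 ?lee_fin ?expR_ge0//.
  by apply: prode_ge0 => i _; exact: poweR_ge0.
have hgt0 j : 0 < \int[nu]_y (h j y)%:E.
  by rewrite lt_neqAle h0 andbT eq_sym; apply/eqP.
have [[j hjoo]|/forallNP hnoo] :=
    pselect (exists j, \int[nu]_y (h j y)%:E = +oo).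
  rewrite [X in _ <= _ * X](_ : _ = +oo) ?gt0_muley ?lte_fin ?expR_gt0 ?leey//.
  rewrite (bigD1 j)//= [X in X `^ _ * _]hjoo poweRyr ?gt_eqF// gt0_mulye//.
  elim/big_ind : _ => [|x y x0 y0|i _]; first exact: lte01.
    exact: mule_gt0.
  exact: (poweR_gt0 _ (hgt0 i)).
have hfin j : \int[nu]_y (h j y)%:E \is a fin_num.
  by rewrite ge0_fin_numE// ltey; apply/eqP/hnoo.
pose I j := fine (\int[nu]_y (h j y)%:E).
have hI j : \int[nu]_y (h j y)%:E = (I j)%:E by rewrite fineK.
have I0 j : (0 < I j)%R by rewrite -lte_fin -hI.
have -> : \prod_(j < m) (\int[nu]_y (phi j y `^ (c j)^-1)%:E) `^ c j =
    (\prod_(j < m) I j `^ c j)%:E.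
  by rewrite -prodEFin; apply: eq_bigr => j _; rewrite hI poweR_EFin.
rewrite -EFinM.
have -> : \int[mu]_x (F x)%:E = \int[mu]_(x in \bigcup_N E N) (F x)%:E.
  rewrite [RHS]integral_mkcond; apply: eq_integral => x _; rewrite patchE.
  case: ifPn => [//|/negP xE]; congr EFin; apply/eqP.
  rewrite eq_le F0 andbT leNgt.
  by apply/negP => /bigcupE xF; apply: xE; exact/mem_set.
have cvF : (\int[mu]_(x in E N) (F x)%:E) @[N --> \oo] -->
    \int[mu]_(x in \bigcup_N E N) (F x)%:E.
  apply: ge0_nondecreasing_set_cvg_integral => //.
  - by move=> N; exact/measurable_funTS/measurable_EFinP.
  - by move=> N x _; rewrite lee_fin.
have <- := cvg_lim _ cvF => //.
apply: lime_le; first exact/cvgP/cvF.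
by apply: nearW => N; exact: integral_good_le.
Qed.

End functional.
End exhaustion.

(** * Lebesgue measure: translations and coordinate deletion *)

Section lebesgue_translation.
Local Open Scope ereal_scope.
Context (R : realType).

Let shift (a : R) : measurableTypeR R -> measurableTypeR R := fun t => (t + a)%R.

Let measurable_shift a : measurable_fun [set: _] (shift a).
Proof. by apply: measurable_funD. Qed.

HB.instance Definition _ a :=
  isMeasurableFun.Build _ _ _ _ (shift a) (@measurable_shift a).

Lemma lebesgue_measure_shift (a : R) (A : set (measurableTypeR R)) :
  measurable A -> lebesgue_measure [set t : R | A (t + a)%R] = lebesgue_measure A.
Proof.
move=> mA; apply/esym.
apply: (lebesgue_measure_unique
  (mu := pushforward lebesgue_measure (shift a))) => // _ [[x y]] _ <-.
transitivity (lebesgue_measure `](x - a)%R, (y - a)%R]%classic); last first.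
  congr (lebesgue_measure _); apply/seteqP.
  by split=> t; rewrite /= /shift !in_itv/= ltrBlDr lerBrDr.
rewrite !lebesgue_measure_itv/= !lte_fin ltrD2r; case: ifPn => // _.
by rewrite -!EFinB; congr EFin; ring.
Qed.

End lebesgue_translation.

Section coordinate_deletion.
Local Open Scope ereal_scope.
Context (R : realType).

Lemma integral_cons_rvec m (F : rvec R m.+1 -> \bar R) :
    measurable_fun [set: _] F -> (forall x, 0 <= F x) ->
  \int[lebesgue_rvec m.+1]_x F x =
  \int[lebesgue_measure]_s \int[lebesgue_rvec m]_y F (cons_rvec (s, y)).
Proof.
move=> mF F0.
have mFc : measurable_fun [set: _] (F \o @cons_rvec R m).
  by apply: measurableT_comp => //; exact: measurable_cons_rvec.
have F0c x : 0 <= (F \o @cons_rvec R m) x by exact: F0.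
rewrite -[RHS](fubini_tonelli1 _ mFc F0c).
by rewrite [LHS]ge0_integral_pushforward//; exact: measurable_cons_rvec.
Qed.

Definition delete_coord m (j : 'I_m) (x : rvec R m) : rvec R m.-1 :=
  [tuple tnth x (lift j i) | i < m.-1].

Lemma measurable_delete_coord m (j : 'I_m) :
  measurable_fun [set: _] (delete_coord j).
Proof.
apply/measurable_fun_tnthP => i.
rewrite (_ : _ \o _ = (@tnth _ _ ^~ (lift j i))); first exact: measurable_tnth.
by apply/funext => p /=; rewrite tnth_mktuple.
Qed.

Lemma delete_coord0 m (s : R) (y : rvec R m) :
  delete_coord ord0 (cons_rvec (s, y)) = y.
Proof. by apply: eq_from_tnth => i; rewrite tnth_mktuple tnthS. Qed.

Lemma delete_coordS m (j : 'I_m.+1) (s : R) (z : rvec R m.+1) :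
  delete_coord (lift ord0 j) (cons_rvec (s, z)) = cons_rvec (s, delete_coord j z).
Proof.
apply: eq_from_tnth => i; rewrite tnth_mktuple.
case: (unliftP (ord0 : 'I_m.+1) i) => [i'|] ->; last first.
  by rewrite (_ : @lift m.+2 _ (ord0 : 'I_m.+1) = ord0)//; exact: val_inj.
rewrite (_ : @lift m.+2 _ (@lift m.+1 _ _) = lift ord0 (lift j i')).
  by rewrite !tnthS tnth_mktuple.
by apply: val_inj => /=; rewrite /bump; lia.
Qed.

(** Any coordinate can be integrated separately. Since the measure is built by
    adding coordinates in front, this goes by induction on [j]: the first
    coordinate splits off by Fubini, and a later one is reached through the
    remaining coordinates. *)
Lemma integral_delete_coord m (j : 'I_m) (k : R -> \bar R)
    (F : rvec R m.-1 -> \bar R) :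
    measurable_fun [set: _] k -> (forall s, 0 <= k s) ->
    measurable_fun [set: _] F -> (forall y, 0 <= F y) ->
  \int[lebesgue_rvec m]_x (k (tnth x j) * F (delete_coord j x)) =
  \int[lebesgue_measure]_s k s * \int[lebesgue_rvec m.-1]_y F y.
Proof.
move=> mk k0.
have mI m' (j' : 'I_m') (F' : rvec R m'.-1 -> \bar R) :
    measurable_fun [set: _] F' ->
    measurable_fun [set: _] (fun x => k (tnth x j') * F' (delete_coord j' x)).
  move=> mF'; apply: emeasurable_funM.
    by apply: measurableT_comp => //; exact: measurable_tnth.
  by apply: measurableT_comp => //; exact: measurable_delete_coord.
have base m' (F' : rvec R m' -> \bar R) : measurable_fun [set: _] F' ->
    (forall y, 0 <= F' y) ->
    \int[lebesgue_rvec m'.+1]_x (k (tnth x ord0) * F' (delete_coord ord0 x)) =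
    \int[lebesgue_measure]_s k s * \int[lebesgue_rvec m']_y F' y.
  move=> mF' F'0.
  rewrite integral_cons_rvec; [|exact: mI|by move=> x; rewrite mule_ge0].
  rewrite -ge0_integralZr//; last exact: integral_ge0.
  apply: eq_integral => s _; rewrite -ge0_integralZl//.
  by apply: eq_integral => y _; rewrite delete_coord0.
case: m j F => [[]//|m]; elim: m => [|m IH] j F mF F0.
  by rewrite (ord1 j); exact: base.
case: (unliftP ord0 j) => [j'|] ->; last exact: base.
rewrite integral_cons_rvec; [|exact: mI|by move=> x; rewrite mule_ge0].
have mFs s : measurable_fun [set: _] (fun y => F (cons_rvec (s, y))).
  apply: (measurableT_comp mF).
  apply: (measurableT_comp (@measurable_cons_rvec R m)).
  exact: measurable_fun_pair.
have mG : measurable_fun [set: measurableTypeR R]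
    (fun s => \int[lebesgue_rvec m]_y F (cons_rvec (s, y))).
  apply: (measurable_fun_fubini_tonelli_F (F \o @cons_rvec R m)) => [|x].
    by apply: (measurableT_comp mF); exact: measurable_cons_rvec.
  exact: F0.
have G0 (s : measurableTypeR R) : [set: measurableTypeR R] s ->
    0 <= \int[lebesgue_rvec m]_y F (cons_rvec (s, y)).
  by move=> _; exact: integral_ge0.
have ik0 : 0 <= \int[lebesgue_measure]_s k s by exact: integral_ge0.
rewrite integral_cons_rvec// -ge0_integralZl//.
apply: eq_integral => s _; rewrite -(IH j')//.
apply: eq_integral => z _; rewrite delete_coordS; congr (k _ * _).
by rewrite tnthS.
Qed.

End coordinate_deletion.

Section slab.
Local Open Scope ereal_scope.
Context (R : realType) (m : nat) (j : 'I_m) (sigma : rvec R m -> R).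

Definition sheared_delete (p : rvect R m) : rvect R m.-1 :=
  (delete_coord j p.1, (p.2 + sigma p.1)%R).

(** Fubini in [t] removes the shear by translation invariance, after which the
    coordinate [x_j] separates from the others: the fibers of [sheared_delete]
    are graphs over the [x_j]-axis and carry its length. *)
Lemma lebesgue_rvect_slab (N : R) (A : set (rvect R m.-1)) : (0 <= N)%R ->
    measurable A ->
  lebesgue_rvect m
    ([set p | `|tnth p.1 j : R| <= N]%R `&` sheared_delete @^-1` A) =
  (2 * N)%:E * lebesgue_rvect m.-1 A.
Proof.
move=> N0 mA; pose I : set R := `[(- N)%R, N]%classic.
pose k := fun s : R => (\1_I s)%:E : \bar R.
have mI : measurable I by exact: measurable_itv.
have mk : measurable_fun [set: _] k by exact/measurable_EFinP.
have k0 s : 0 <= k s by rewrite lee_fin.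
have mlA : measurable_fun [set: _] (fun y => lebesgue_measure (xsection A y)).
  exact: measurable_fun_xsection.
have -> : (2 * N)%:E = \int[lebesgue_measure]_s k s.
  have -> : \int[lebesgue_measure]_s k s = lebesgue_measure I.
    by rewrite /k integral_indic// setIT.
  rewrite lebesgue_measure_itv/= lte_fin.
  case: ltP => [_|NN]; first by rewrite -EFinB; congr EFin; ring.
  by congr EFin; lra.
rewrite /lebesgue_rvect -[RHS](integral_delete_coord j mk k0 mlA)//.
apply: eq_integral => x _; rewrite /k indicE.
case: (boolP (tnth x j \in I)) => xI.
  rewrite mul1e -(lebesgue_measure_shift (sigma x)); last first.
    exact: measurable_xsection.
  congr (lebesgue_measure _); apply/seteqP; split=> t /=; rewrite !xsectionE//=.
    by case.
  move=> At; split=> //.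
  by move: xI; rewrite inE /I/= in_itv/= ler_norml.
rewrite mul0e -(measure0 (@lebesgue_measure R)).
congr (lebesgue_measure _); rewrite -subset0 xsectionE => t [/= xN _].
move/negP: xI; apply; rewrite inE /I/= in_itv/=.
by rewrite -ler_norml.
Qed.

End slab.

(** * The fibers of the projections of the group *)

Section box.
Local Open Scope ereal_scope.
Context (R : realType) (m : nat).

Definition rvect_box (M N : R) : set (rvect R m) :=
  [set p | (forall i, `|tnth p.1 i : R| <= M)%R /\ (`|p.2 : R| <= N)%R].

Let cube (M : R) : set (rvec R m) :=
  [set x | forall i, `[(- M)%R, M]%classic (tnth x i)].

Let rvect_boxE M N : rvect_box M N = cube M `*` `[(- N)%R, N]%classic.
Proof.
apply/seteqP; split => -[x t] [/= xM tN]; (split; last first).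
- by rewrite /= in_itv/= -ler_norml.
- by move=> i /=; rewrite in_itv/= -ler_norml; exact: xM.
- by move: tN; rewrite /= in_itv/= -ler_norml.
- by move=> i; have := xM i; rewrite /= in_itv/= -ler_norml.
Qed.

Let measurable_sym_itv (M : R) :
  measurable (`[(- M)%R, M]%classic : set (measurableTypeR R)).
Proof. exact: measurable_itv. Qed.

Let measurable_cube M : measurable (cube M).
Proof.
rewrite (_ : cube M = \bigcap_(i in [set: 'I_m])
    ((fun x : rvec R m => tnth x i) @^-1` `[(- M)%R, M]%classic)); last first.
  by apply/seteqP; split=> x H i; [move=> _|]; exact: H.
apply: fin_bigcap_measurable => // i _.
have mi : measurable_fun [set: rvec R m] (fun x : rvec R m => tnth x i).
  exact: measurable_tnth.
rewrite -[X in measurable X]setTI.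
exact: (mi measurableT _ (measurable_sym_itv M)).
Qed.

Lemma measurable_rvect_box M N : measurable (rvect_box M N).
Proof. by rewrite rvect_boxE; apply: measurableX => //; exact: measurable_itv. Qed.

Let lebesgue_itv_lty (N : R) :
  lebesgue_measure (`[(- N)%R, N]%classic : set R) < +oo.
Proof.
by rewrite lebesgue_measure_itv/=; case: ifPn => _; rewrite -?EFinB ltry.
Qed.

Lemma lebesgue_rvect_box_lty M N : lebesgue_rvect m (rvect_box M N) < +oo.
Proof.
rewrite rvect_boxE /lebesgue_rvect.
rewrite (product_measure1E _ _ (measurable_cube M) (measurable_sym_itv N)).
rewrite lte_mul_pinfty//; last exact: lebesgue_itv_lty.
rewrite [X in X \is a _](@lebesgue_rvec_box R m
  (fun _ => `[(- M)%R, M]%classic))//.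
apply: prode_fin_num => i _; rewrite ge0_fin_numE//; exact: lebesgue_itv_lty.
Qed.

Lemma nondecreasing_rvect_box :
  nondecreasing_seq (fun N : nat => rvect_box N%:R N%:R).
Proof.
move=> N N' NN'; apply/subsetPset => p [xN tN]; split=> [i|].
  by apply: le_trans (xN i) _; rewrite ler_nat.
by apply: le_trans tN _; rewrite ler_nat.
Qed.

Lemma bigcup_rvect_box :
  \bigcup_(N : nat) rvect_box N%:R N%:R = [set: rvect R m].
Proof.
rewrite -subTset => p _.
pose M := (`|p.2| + \sum_(i < m) `|tnth p.1 i|)%R.
have M0 : (0 <= \sum_(i < m) `|tnth p.1 i : R|)%R by exact: sumr_ge0.
exists (Num.truncn M).+1 => //.
have MN : (M <= (Num.truncn M).+1%:R)%R by exact/ltW/truncnS_gt.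
split=> [i|]; apply: le_trans MN.
  rewrite /M (bigD1 i)//= addrCA lerDl addr_ge0//; exact: sumr_ge0.
by rewrite /M lerDl.
Qed.

End box.

Section corank1_fibers.
Local Open Scope ereal_scope.
Context (R : realType) (d n : nat) (alpha : n.-tuple R).
Notation m := (d + 2 * n)%N.

Let shear (j : 'I_m) (x : rvec R m) : R := corank1_proj_t d alpha j x 0.

Lemma corank1_projE (j : 'I_m) : corank1_proj alpha j = sheared_delete j (shear j).
Proof.
apply/funext => -[x t]; congr pair; rewrite /shear /corank1_proj_t/=.
by case: ifP => _; [rewrite addr0|case: ifP => _; rewrite ?add0r ?sub0r].
Qed.

Lemma shear_le (j : 'I_m) (N : R) (x : rvec R m) : (0 <= N)%R ->
  (forall i, `|tnth x i : R| <= N)%R ->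
  (`|shear j x| <= `|alpha`_((j - d)./2) / 2| * (N * N))%R.
Proof.
move=> N0 xN.
have nthN k : (`|(x : seq R)`_k| <= N)%R.
  have [km|mk] := ltnP k m; last by rewrite nth_default ?normr0// size_tuple.
  by rewrite -(tnth_nth (0%R : R) x (Ordinal km)).
rewrite /shear /corank1_proj_t; case: ifP => _.
  by rewrite normr0 !mulr_ge0.
by case: ifP => _; rewrite ?add0r ?sub0r ?normrN normrM
  [X in (_ * X <= _)%R]normrM ler_wpM2l// ler_pM.
Qed.

(** The projection of a box lies in a larger box, the shear being bounded on
    boxes, and the slab [`|x_j| <= N] has fibers of length [2 * N]. *)
Lemma corank1_bounded_fibers (j : 'I_m) (N : R) : (0 <= N)%R ->
  bounded_fibers (lebesgue_rvect m) (lebesgue_rvect m.-1)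
    (corank1_proj alpha j) (@rvect_box R m N N).
Proof.
move=> N0; pose N' := (N + `|alpha`_((j - d)./2) / 2| * (N * N))%R.
exists (2 * N)%R, (@rvect_box R m.-1 N N'); split.
- exact: measurable_rvect_box.
- exact: lebesgue_rvect_box_lty.
move=> A mA.
have mAB : measurable (A `&` @rvect_box R m.-1 N N').
  by apply: measurableI => //; exact: measurable_rvect_box.
have mpi B : measurable B -> measurable (corank1_proj alpha j @^-1` B).
  by move=> mB; rewrite -[X in measurable X]setTI; exact: measurable_corank1_proj.
rewrite -(lebesgue_rvect_slab j (shear j) N0 mAB) -corank1_projE.
apply: le_measure; rewrite ?inE.
- by apply: measurableI; [exact: measurable_rvect_box|exact: mpi].
- apply: measurableI; last exact: mpi.
  rewrite (_ : [set p | _] =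
      (fun p : rvect R m => tnth p.1 j) @^-1` (`[(- N)%R, N]%classic)).
    have mj : measurable_fun [set: rvect R m] (fun p => tnth p.1 j).
      exact: (measurableT_comp (measurable_tnth _)).
    have mN : measurable (`[(- N)%R, N]%classic : set (measurableTypeR R)).
      exact: measurable_itv.
    by rewrite -[X in measurable X]setTI; exact: (mj measurableT _ mN).
  by apply/seteqP; split=> p /=; rewrite in_itv/= -ler_norml.
- move=> p [[xN tN] Ap]; split; first exact: xN.
  split; first exact: Ap.
  rewrite corank1_projE; split=> [i|].
    by rewrite /= tnth_mktuple; exact: xN.
  by rewrite /= (le_trans (ler_normD _ _))// lerD//; exact: shear_le.
Qed.

End corank1_fibers.

(** * Densities of the projected laws *)

Section Radon_Nikodym_density.
Local Open Scope ereal_scope.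
Context d (Y : measurableType d) (R : realType).
Variable nu : {sigma_finite_measure set Y -> \bar R}.
Variable P : probability Y R.
Hypothesis Pnu : P `<< nu.

Let v (y : Y) : R := fine (Radon_Nikodym (charge_of_finite_measure P) nu y).

Let vE y : Radon_Nikodym (charge_of_finite_measure P) nu y = (v y)%:E.
Proof. by rewrite fineK//; exact: Radon_Nikodym_fin_num. Qed.

Let iv : nu.-integrable [set: Y] (EFin \o v).
Proof.
exact: eq_integrable
  (Radon_Nikodym_integrable (nu := charge_of_finite_measure P) Pnu).
Qed.

Let mv : measurable_fun [set: Y] v.
Proof. exact/measurable_EFinP/measurable_int/iv. Qed.

Let v_int A : measurable A -> \int[nu]_(y in A) (v y)%:E = P A.
Proof.
move=> mA.
rewrite [RHS](Radon_Nikodym_integral (nu := charge_of_finite_measure P) Pnu mA).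
by apply: eq_integral => y _; rewrite vE.
Qed.

Let g y := Num.max 0%R (v y).

Let mg : measurable_fun [set: Y] g.
Proof. exact: measurable_maxr. Qed.

Let g0 y : (0 <= g y)%R. Proof. by rewrite le_max lexx. Qed.

Let g_int A : measurable A -> \int[nu]_(y in A) (g y)%:E = P A.
Proof.
move=> mA; rewrite -v_int//; apply: ae_eq_integral => //.
- exact/measurable_funTS/measurable_EFinP.
- exact/measurable_funTS/measurable_EFinP.
have : {ae nu, forall y, (cst 0 y <= v y)%R}.
  apply: ae_le_from_integral => // [|B mB].
    exact: integrable0.
  by rewrite v_int// integral0.
by apply: filterS => y v0 _; rewrite /g max_r.
Qed.

Let g_int1 : \int[nu]_y (g y)%:E = 1.
Proof. by rewrite g_int// probability_setT. Qed.

(** The Radon-Nikodym derivative [v] may be negative on a null set. Its positive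
    part is a density, with the same entropy since [ln] vanishes on negative
    numbers. *)
Lemma Radon_Nikodym_density : exists g : density nu,
  (forall A, measurable A -> P A = density_law g A) /\
  entropy nu g = entropy nu v.
Proof.
exists (Density mg g0 g_int1); split=> [A mA|]; first by rewrite -g_int.
apply: eq_integral => y _; rewrite /= /g; case: (leP 0%R (v y)) => // v0.
by rewrite mul0r (ln0 (ltW v0)) mulr0.
Qed.

End Radon_Nikodym_density.

Section corank1_duality.
Local Open Scope ereal_scope.
Context (R : realType) (d n : nat) (alpha : n.-tuple R).
Notation m := (d + 2 * n)%N.
Notation K := (fun N : nat => @rvect_box R m N%:R N%:R).

Lemma bounded_densityP (f : density (@lebesgue_rvect R m)) :
  bounded_density f <-> bounded_supported K f.
Proof.
split=> [[[M [_ fM]] [N fN]]|[[M fM] [N fN]]].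
  split.
    exists (M + 1)%R => x; apply: le_trans (ler_norm _) _.
    by apply: fM => //; rewrite ltrDl.
  exists (Num.truncn `|N|).+1 => p /fN[xN tN].
  have NN : (N <= (Num.truncn `|N|).+1%:R)%R.
    by apply: le_trans (ler_norm _) _; exact/ltW/truncnS_gt.
  by split=> [i|]; apply: le_trans NN; [exact: xN|exact: tN].
split; last by exists N%:R => p /fN[xN tN].
exists M; split; first exact: num_real.
by move=> M' MM' x _; rewrite /= ger0_norm ?density_ge0// (le_trans (fM x))// ltW.
Qed.

Let mu : {sigma_finite_measure set (rvect R m) -> \bar R} := @lebesgue_rvect R m.
Let nu : {sigma_finite_measure set (rvect R m.-1) -> \bar R} :=
  @lebesgue_rvect R m.-1.

Let fiberK j N : bounded_fibers mu nu (corank1_proj alpha j) (K N).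
Proof. exact: corank1_bounded_fibers. Qed.

Lemma corank1_marginal j (f : density mu) :
  exists g : density nu, marginal (corank1_proj alpha j) f g /\
    entropy nu g = entropy nu (corank1_density alpha j f).
Proof.
pose P : probability _ R := distribution (density_law f) (corank1_proj alpha j).
have Pnu : P `<< nu.
  apply/null_content_dominatesP => A mA A0.
  have mpA : measurable (corank1_proj alpha j @^-1` A).
    by rewrite -[X in measurable X]setTI; exact: measurable_corank1_proj.
  have mK N : measurable (K N) by exact: measurable_rvect_box.
  have pA0 : mu (corank1_proj alpha j @^-1` A) = 0.
    exact: (preimage_null (measurable_corank1_proj alpha) mK
      (bigcup_rvect_box R m) fiberK j mA A0).
  have /null_content_dominatesP := density_law_dominates f.
  exact.
have [g [gP gE]] := Radon_Nikodym_density Pnu.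
by exists g; split => // A mA; rewrite -gP.
Qed.

Lemma corank1_marginals (f : density mu) :
  exists g : 'I_m -> density nu, forall j,
    marginal (corank1_proj alpha j) f (g j) /\
    entropy nu (g j) = entropy nu (corank1_density alpha j f).
Proof.
exists (fun j => sval (cid (corank1_marginal j f))) => j.
by case: cid => g.
Qed.

End corank1_duality.

(** * The duality theorem *)

Theorem theorem6 (R : realType) (d n : nat) (alpha : n.-tuple R)
    (D : R) (c : 'I_(d + 2 * n) -> R)
    (n_ge1 : (1 <= n)%N)
    (alpha_gt0 : 0 < alpha`_0) (alpha_sorted : sorted <=%R alpha)
    (c_gt0 : forall j, 0 < c j) :
  (forall f : 'I_(d + 2 * n) -> rvect R (d + 2 * n).-1 -> R,
     (forall j, measurable_fun [set: _] (f j)) ->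
     (forall j y, 0 <= f j y) ->
     (\int[lebesgue_rvect (d + 2 * n)]_p
        (\prod_(j < d + 2 * n) f j (corank1_proj alpha j p))%R%:E
      <= (expR D)%:E * \prod_(j < d + 2 * n)
           (\int[lebesgue_rvect (d + 2 * n).-1]_y (f j y `^ (c j)^-1)%:E)
             `^ c j)%E)
  <->
  (forall f : density (@lebesgue_rvect R (d + 2 * n)), bounded_density f ->
     (\sum_(j < d + 2 * n)
        (c j)%:E * entropy (lebesgue_rvect (d + 2 * n).-1)
                           (corank1_density alpha j f)
      <= entropy (lebesgue_rvect (d + 2 * n)) f + D%:E)%E).
Proof.
have mK N : measurable (@rvect_box R (d + 2 * n) N%:R N%:R).
  exact: measurable_rvect_box.
have Koo N : (lebesgue_rvect (d + 2 * n)
    (@rvect_box R (d + 2 * n) N%:R N%:R) < +oo)%E.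
  exact: lebesgue_rvect_box_lty.
have fiberK j N : bounded_fibers (lebesgue_rvect (d + 2 * n))
    (lebesgue_rvect (d + 2 * n).-1) (corank1_proj alpha j)
    (@rvect_box R (d + 2 * n) N%:R N%:R).
  exact: corank1_bounded_fibers.
have mpi := @measurable_corank1_proj R d n alpha.
split=> [functional f /bounded_densityP bf|entropic phi mphi phi0].
  have [g gP] := corank1_marginals alpha f.
  have fg j : marginal (corank1_proj alpha j) f (g j) by case: (gP j).
  under eq_bigr do rewrite -(gP _).2.
  apply: (entropy_le_of_functional mpi fg (integrable_entropy mK Koo bf)
    (fun j => integrable_entropy_marginal mpi mK fiberK bf (fg j))).
  (* these powers make every factor on the right-hand side equal to 1 *)
  pose phi j y := g j y `^ c j.
  have := functional phi.
  rewrite [X in (_ * X)%E]big1 ?mule1 => [|j _].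
    apply=> [j|j y]; last exact: powR_ge0.
    by apply: (measurableT_comp (measurable_powR _)); exact: density_measurable.
  rewrite (_ : (\int[_]_y _ = 1)%E) ?poweR1r// -[RHS](density_int1 (g j)).
  apply: eq_integral => y _; rewrite /phi -powRrM mulfV ?gt_eqF//.
  by rewrite powRr1// density_ge0.
have ndK := @nondecreasing_rvect_box R (d + 2 * n).
have KT := @bigcup_rvect_box R (d + 2 * n).
apply: (functional_of_entropy mpi mK Koo ndK KT fiberK c_gt0 mphi phi0).
move=> f /bounded_densityP bf; have [g gP] := corank1_marginals alpha f.
exists g; split=> [j|]; first by case: (gP j).
by under eq_bigr do rewrite (gP _).2; exact: entropic.
Qed.
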